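(* Let $p$ be a prime, $P(t) \in \mathbb{Z}_p[t]$ non-constant monic of degree $d$, $R := \mathbb{Z}_p[t]/(P(t))$, and $\bar t \in R$ the image of $t$. Let $n \in \mathbb{Z}_{\geq 1}$, $A_n \in \mathrm{M}_n(\mathbb{F}_p)$, and $G$ a finite $R$-module. For any $pY_1, \dots, pY_{d-1} \in p\mathrm{M}_n(\mathbb{Z}_p)$, \[\underset{X \in \mathrm{M}_n(\mathbb{Z}_p)_{A_n}}{\mathrm{Prob}}\big(\mathrm{cok}_R(X - \bar t I_n) \simeq_R G\big) = \underset{X \in \mathrm{M}_n(\mathbb{Z}_p)_{A_n}}{\mathrm{Prob}}\big(\mathrm{cok}_R(X + \bar t(pY_1 - I_n) + \bar t^2 pY_2 + \cdots + \bar t^{d-1} pY_{d-1}) \simeq_R G\big).\]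
   Context: $\mathrm{M}_n(\mathbb{Z}_p)_{A_n} := \{X \in \mathrm{M}_n(\mathbb{Z}_p) : X \equiv A_n \pmod p\}$, equipped with the probability measure induced from the Haar measure on $\mathrm{M}_n(\mathbb{Z}_p)$. For $Z \in \mathrm{M}_n(R)$, $\mathrm{cok}_R(Z) := R^n/ZR^n$. *)

(* Defs.v *)
From HB Require Import structures.
From mathcomp Require Import all_boot all_order all_algebra.
From mathcomp Require Import generic_quotient ring_quotient qpoly.
From mathcomp Require Import all_classical all_reals all_analysis.

Set Implicit Arguments.
Unset Strict Implicit.
Unset Printing Implicit Defensive.

Import Order.TTheory GRing.Theory Num.Theory.

Local Open Scope classical_set_scope.
Local Open Scope ring_scope.

(* The p-adic integers, as the inverse limit of the rings Z/p^(k+1), k >= 0.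
   The exponent starts at 1 because 'Z_1 is Z/2Z in MathComp.  Only prime p
   are meant, but the ring structure exists for every p. *)
Section PadicIntegers.
Variable p : nat.

Definition residue_seq := forall k, 'Z_(p ^ k.+1).

HB.instance Definition _ :=
  Choice.copy residue_seq (forall k, 'Z_(p ^ k.+1)).

Implicit Types x y z : residue_seq.

Let rs_zero : residue_seq := fun=> 0.
Let rs_opp x : residue_seq := fun k => - x k.
Let rs_add x y : residue_seq := fun k => x k + y k.
Let rs_one : residue_seq := fun=> 1.
Let rs_mul x y : residue_seq := fun k => x k * y k.

Let rs_addA : associative rs_add.
Proof.
by move=> x y z; apply: functional_extensionality_dep => k; exact: addrA. Qed.
Let rs_addC : commutative rs_add.
Proof.
by move=> x y; apply: functional_extensionality_dep => k; exact: addrC. Qed.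
Let rs_add0 : left_id rs_zero rs_add.
Proof. by move=> x; apply: functional_extensionality_dep => k; exact: add0r. Qed.
Let rs_addN : left_inverse rs_zero rs_opp rs_add.
Proof. by move=> x; apply: functional_extensionality_dep => k; exact: addNr. Qed.
HB.instance Definition _ :=
  GRing.isZmodule.Build residue_seq rs_addA rs_addC rs_add0 rs_addN.

Let rs_mulA : associative rs_mul.
Proof.
by move=> x y z; apply: functional_extensionality_dep => k; exact: mulrA. Qed.
Let rs_mulC : commutative rs_mul.
Proof.
by move=> x y; apply: functional_extensionality_dep => k; exact: mulrC. Qed.
Let rs_mul1 : left_id rs_one rs_mul.
Proof. by move=> x; apply: functional_extensionality_dep => k; exact: mul1r. Qed.
Let rs_mulD : left_distributive rs_mul +%R.
Proof.
by move=> x y z; apply: functional_extensionality_dep => k; exact: mulrDl. Qed.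
Let rs_1neq0 : rs_one != 0.
Proof.
apply/eqP => /(congr1 (fun x : residue_seq => x 0%N)) /eqP.
by rewrite (_ : _ == _ = (1 == 0 :> 'Z_(p ^ 1))) // oner_eq0.
Qed.
HB.instance Definition _ :=
  GRing.Zmodule_isComNzRing.Build residue_seq
    rs_mulA rs_mulC rs_mul1 rs_mulD rs_1neq0.

Definition reduce k (a : 'Z_(p ^ k.+2)) : 'Z_(p ^ k.+1) := (a : nat)%:R.

Definition coherent : {pred residue_seq} :=
  fun x => `[< forall k, reduce (x k.+1) = x k >].

Lemma Zp_trunc_dvd k :
  ((Zp_trunc (p ^ k.+1)).+2 %| (Zp_trunc (p ^ k.+2)).+2)%N.
Proof.
have [p1|p_le1] := ltnP 1 p.
  have lt1 j : (1 < p ^ j.+1)%N by rewrite -{1}(expn0 p) ltn_exp2l.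
  by rewrite !Zp_cast // dvdn_exp2l.
by case: p p_le1 => [|[|//]] _; rewrite ?exp1n // !exp0n.
Qed.

Lemma reduceE k m : reduce (m%:R : 'Z_(p ^ k.+2)) = m%:R.
Proof.
apply: val_inj; rewrite /reduce !Zp_nat /=.
by rewrite modn_dvdm // Zp_trunc_dvd.
Qed.

Lemma reduce1 k : reduce (1 : 'Z_(p ^ k.+2)) = 1.
Proof. exact: (reduceE k 1). Qed.

Lemma reduceD k : {morph @reduce k : a b / a + b}.
Proof.
move=> a b; have /= := reduceE k (a + b)%N.
by rewrite !natrD !natr_Zp.
Qed.

Lemma reduceM k : {morph @reduce k : a b / a * b}.
Proof.
move=> a b; have /= := reduceE k (a * b)%N.
by rewrite !natrM !natr_Zp.
Qed.

Lemma reduceB k : {morph @reduce k : a b / a - b}.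
Proof.
by move=> a b; apply/(addIr (reduce b)); rewrite -reduceD !subrK.
Qed.

Lemma coherent_subring_closed : subring_closed coherent.
Proof.
split=> [|x y /asboolP cx /asboolP cy|x y /asboolP cx /asboolP cy];
  apply/asboolP => k.
- exact: reduce1.
- by rewrite -[RHS]/(x k - y k) -cx -cy -reduceB.
- by rewrite -[RHS]/(x k * y k) -cx -cy -reduceM.
Qed.

HB.instance Definition _ :=
  GRing.isSubringClosed.Build residue_seq coherent coherent_subring_closed.

Record padic_int : Type := PadicInt {
  residue : residue_seq;
  _ : residue \in coherent }.

HB.instance Definition _ := [isSub for residue].
HB.instance Definition _ := [Choice of padic_int by <:].
HB.instance Definition _ := [SubChoice_isSubComNzRing of padic_int by <:].
HB.instance Definition _ := isPointed.Build padic_int 0.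

(* The p-adic topology: the classes of x modulo p^(k+1) form a basis of
   neighbourhoods of x. *)
Definition padic_nbhs (x : padic_int) : set_system padic_int :=
  filter_from [set: nat] (fun k => [set y | residue y k = residue x k]).

HB.instance Definition _ := hasNbhs.Build padic_int padic_nbhs.

Lemma padic_residue_le (x y : padic_int) k l :
  (k <= l)%N -> residue y l = residue x l -> residue y k = residue x k.
Proof.
elim: l => [|l IH]; first by rewrite leqn0 => /eqP->.
rewrite leq_eqVlt => /orP[/eqP->//|kl] yx; apply: IH => //.
case: x y yx => [x cx] [y cy] /= yx.
by move/asboolP: cx => <-; move/asboolP: cy => <-; rewrite yx.
Qed.

Lemma padic_nbhs_filter (x : padic_int) : ProperFilter (nbhs x).
Proof.
apply: filter_from_proper; last by move=> k _; exists x.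
apply: filter_from_filter; first by exists 0%N.
move=> k l _ _; exists (maxn k l) => // y yx; split.
  exact: padic_residue_le (leq_maxl k l) yx.
exact: padic_residue_le (leq_maxr k l) yx.
Qed.

Lemma padic_nbhs_singleton (x : padic_int) (A : set padic_int) :
  nbhs x A -> A x.
Proof. by case=> k _; exact. Qed.

Lemma padic_nbhs_nbhs (x : padic_int) (A : set padic_int) :
  nbhs x A -> nbhs x (nbhs^~ A).
Proof.
case=> k _ kA; exists k => // y yx; exists k => // z zy.
by apply: kA; rewrite /= zy.
Qed.

HB.instance Definition _ := Nbhs_isNbhsTopological.Build padic_int
  padic_nbhs_filter padic_nbhs_singleton padic_nbhs_nbhs.

Definition padic_mod_p (x : padic_int) : 'F_p := (residue x 0%N : nat)%:R.

End PadicIntegers.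

Section Haar.
Variables (p n : nat) (K : realType).

Definition borel_padic_mx := g_sigma_algebraType (@open 'M[padic_int p]_n).

(* As mu has total mass 1, this determines mu uniquely: it is the normalised
   Haar measure of the compact group (M_n(Z_p), +). *)
Definition is_haar (mu : probability borel_padic_mx K) : Prop :=
  forall (X : 'M[padic_int p]_n) (B : set borel_padic_mx), measurable B ->
    mu [set X + (Y : 'M[padic_int p]_n) | Y in B] = mu B.

Definition residue_class (A : 'M['F_p]_n) : set 'M[padic_int p]_n :=
  [set X | map_mx (@padic_mod_p p) X = A].

(* The probability of E for the measure induced by mu on the open subset
   residue_class A, whose mass is p^(-n^2) when p is prime. *)
Definition class_prob (mu : probability borel_padic_mx K) (A : 'M['F_p]_n)
    (E : set 'M[padic_int p]_n) : K :=
  fine (mu (residue_class A `&` E)) / fine (mu (residue_class A)).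

End Haar.

Section Cokernel.
Variables (R : comNzRingType) (n : nat) (Z : 'M[R]_n).

Definition mx_image : {pred 'cV[R]_n} :=
  fun v => `[< exists w : 'cV[R]_n, v = Z *m w >].

Lemma mx_image_submod_closed : submod_closed mx_image.
Proof.
split=> [|a u v /asboolP[w ->] /asboolP[w' ->]]; apply/asboolP.
  by exists 0; rewrite mulmx0.
by exists (a *: w + w'); rewrite mulmxDr scalemxAr.
Qed.

HB.instance Definition _ :=
  GRing.isSubmodClosed.Build R 'cV[R]_n mx_image mx_image_submod_closed.

Definition cok : Type := Quotient.quot mx_image.

HB.instance Definition _ := GRing.Zmodule.on cok.
HB.instance Definition _ := EqQuotient.on cok.

Local Open Scope quotient_scope.

Definition cok_scale (a : R) (u : cok) : cok := \pi_cok (a *: repr u).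

Lemma cok_scale_pi a v : cok_scale a (\pi_cok v) = \pi_cok (a *: v).
Proof.
apply/eqP; rewrite /cok_scale -Quotient.idealrBE -scalerBr.
by rewrite rpredZ // Quotient.idealrBE reprK.
Qed.

Let cok_piD : {morph (\pi_cok : 'cV[R]_n -> cok) : u v / u + v}.
Proof. exact: (raddfD \pi_(Quotient.quot mx_image)). Qed.

Let cok_scaleA a b (u : cok) : cok_scale a (cok_scale b u) = cok_scale (a * b) u.
Proof. by rewrite [cok_scale b u]/cok_scale cok_scale_pi scalerA. Qed.
Let cok_scale1 : left_id 1 cok_scale.
Proof. by move=> u; rewrite /cok_scale scale1r reprK. Qed.
Let cok_scaleDr : right_distributive cok_scale +%R.
Proof.
move=> a u v; rewrite -{1}[u]reprK -{1}[v]reprK -cok_piD cok_scale_pi.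
by rewrite scalerDr cok_piD.
Qed.
Let cok_scaleDl (u : cok) : {morph cok_scale^~ u : a b / a + b}.
Proof. by move=> a b; rewrite /cok_scale scalerDl cok_piD. Qed.

HB.instance Definition _ := GRing.Zmodule_isLmodule.Build R cok
  cok_scaleA cok_scale1 cok_scaleDr cok_scaleDl.

End Cokernel.

Definition lmod_isomorphic (R : nzRingType) (U V : lmodType R) : Prop :=
  exists f : {linear U -> V}, bijective f.

(* Main.v *)
From HB Require Import structures.
Require Import Defs.
From mathcomp Require Import all_boot all_order all_algebra.
From mathcomp Require Import generic_quotient ring_quotient qpoly ring.
From mathcomp Require Import all_classical all_reals all_analysis.

(* Dividing the matrix polynomial X - t + sum_i t^i pY_i on the left by X' - t
   leaves the remainder X - X' + sum_i X'^i pY_i and a quotient congruent to 1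
   modulo p.  So for X = psi(X') := X' - p sum_i X'^i Y_i the two matrices
   differ by a right factor 1 + pW, which is invertible over R because p lies
   in the Jacobson radical of R.  The map psi preserves the class of X' mod p
   and induces a permutation of M_n(Z/p^(k+1)) for every k, p being nilpotent
   there.  If #|G| = p^k u with u prime to p, then #|G| annihilates a cokernel
   isomorphic to G, and a perturbation of Z by #|G| p B multiplies Z by a unit
   1 + pVB: both events are unions of classes mod p^(k+1).  All these classes
   have the same Haar measure, and psi matches those of the two events. *)

Set Implicit Arguments.
Unset Strict Implicit.
Unset Printing Implicit Defensive.

Import Order.TTheory GRing.Theory Num.Theory.

Local Open Scope classical_set_scope.
Local Open Scope ring_scope.

(** * Jacobson radical and invertibility of matrices *)

Definition in_jacobson (R : comNzRingType) (a : R) : Prop :=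
  forall r, exists s, (1 + a * r) * s = 1.

(** The determinant is the value at [a] of a polynomial in one variable that equals 1 at 0, so the
    variable divides it up to that constant. *)
Lemma det_add1Z (R : comNzRingType) (n : nat) (a : R) (W : 'M[R]_n) :
  exists r, \det (1%:M + a *: W) = 1 + a * r.
Proof.
pose q : {poly R} := \det (1%:M + 'X *: map_mx polyC W).
have qE x : q.[x] = \det (1%:M + x *: W).
  rewrite -[q.[x]]/(horner_eval x q) -det_map_mx; congr (\det _).
  by apply/matrixP => i j; rewrite !mxE /= /horner_eval !hornerE hornerMn hornerE.
have /factor_theorem[h qh] : root (q - 1) 0.
  by rewrite /root hornerD qE scale0r addr0 det1 !hornerE subrr.
exists h.[a]; rewrite -qE -[q](subrK 1) qh !hornerE.
by rewrite subr0 addrC mulrC.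
Qed.

Lemma jacobson_mx (R : comNzRingType) (n : nat) (a : R) (W : 'M[R]_n) :
  in_jacobson a -> exists V, (1%:M + a *: W) *m V = 1%:M.
Proof.
have [r detE] := det_add1Z a W => /(_ r)[s rs1].
exists (s *: \adj (1%:M + a *: W)).
by rewrite -scalemxAr mul_mx_adj detE scale_scalar_mx mulrC rs1.
Qed.

(** Determinant trick: if [M] expresses multiplication by [r] on the generators [b], then
    multiplication by [1 + a r] acts on coordinates as [1 + a M]. That matrix is invertible over
    [A], so [1 + a r] acts surjectively on [R] and reaches 1. *)
Lemma jacobson_finite (A : comNzRingType) (R : comAlgType A) (N : nat)
    (b : 'I_N -> R) (a : A) :
  (forall x, exists v : 'rV_N, x = \sum_i v 0 i *: b i) ->
  in_jacobson a -> in_jacobson (a%:A : R).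
Proof.
move=> gen_b jac_a r.
have [c cE] := choice gen_b.
pose M := \matrix_(i, j) c (r * b i) 0 j.
pose phi (v : 'rV_N) := \sum_i v 0 i *: b i.
have phiM v : (1 + a%:A * r) * phi v = phi (v *m (1%:M + a *: M)).
  rewrite /phi mulr_sumr.
  under [RHS]eq_bigr do rewrite mxE scaler_suml.
  rewrite exchange_big; apply: eq_bigr => i _ /=.
  under eq_bigr do rewrite mxE -scalerA scalerDl !mxE.
  rewrite -scaler_sumr -scalerAr; congr (_ *: _).
  rewrite big_split mulrDl mul1r /= (bigD1 i) //= eqxx scale1r big1 ?addr0.
    rewrite mulr_algl -scalerAl {1}[r * b i]cE scaler_sumr.
    by congr (_ + _); apply: eq_bigr => j _; rewrite scalerA.
  by move=> j /negPf; rewrite eq_sym => ->; rewrite scale0r.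
have [V MV] := jacobson_mx M jac_a.
exists (phi (c 1 *m V)).
by rewrite phiM -mulmxA (mulmx1C MV) mulmx1 /phi -cE.
Qed.

Lemma jacobson_qpoly (A : comNzRingType) (h : {poly A}) (a : A) :
  in_jacobson a -> in_jacobson (qpolyC h a).
Proof.
have -> : qpolyC h a = a%:A.
  by apply: val_inj; rewrite /= -alg_polyC.
(* The generators are the powers of t below the degree of the effective modulus [mk_monic h], which
   is [h] when [h] is monic and non-constant, and 'X otherwise. *)
apply: (@jacobson_finite _ _ _ (fun i : 'I_(size (mk_monic h)).-1 => in_qpoly h 'X^i)).
move=> x; exists (\row_i x`_i).
have {1}-> : x = in_qpoly h (\poly_(i < (size (mk_monic h)).-1) x`_i).
  apply: val_inj; rewrite [RHS]in_qpoly_small.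
    apply/polyP => k; rewrite coef_poly; case: ltnP => // le_k.
    by rewrite nth_default // (leq_trans (size_npoly x)).
  by rewrite (leq_ltn_trans (size_poly _ _)) // prednK ?size_mk_monic_gt0.
rewrite poly_def linear_sum; apply: eq_bigr => i _.
by rewrite linearZ mxE.
Qed.

(** * Residues modulo p^(k+1) *)

Section Residue.
Variable p : nat.

Definition res k (x : padic_int p) : 'Z_(p ^ k.+1) := residue x k.

Lemma res_is_zmod_morphism k : zmod_morphism (res k).
Proof. by []. Qed.
Lemma res_is_monoid_morphism k : monoid_morphism (res k).
Proof. by []. Qed.
HB.instance Definition _ k :=
  GRing.isZmodMorphism.Build _ _ (res k) (res_is_zmod_morphism k).
HB.instance Definition _ k :=
  GRing.isMonoidMorphism.Build _ _ (res k) (res_is_monoid_morphism k).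

Lemma reduce_res k x : reduce (res k.+1 x) = res k x.
Proof. by case: x => x cx; have /asboolP := cx; exact. Qed.

Lemma res_inj x y : (forall k, res k x = res k y) -> x = y.
Proof. by move=> xy; apply: val_inj; apply: functional_extensionality_dep. Qed.

Lemma res_surj k a : exists x, res k x = a.
Proof. by exists (a : nat)%:R; rewrite rmorph_nat natr_Zp. Qed.

Lemma res_lift (f : residue_seq p) :
  (forall k, reduce (f k.+1) = f k) -> exists x, forall k, res k x = f k.
Proof. by move=> /asboolP fP; exists (PadicInt fP). Qed.

Hypothesis p_prime : prime p.

Lemma Zp_cast_exp k : (Zp_trunc (p ^ k.+1)).+2 = (p ^ k.+1)%N.
Proof. by rewrite Zp_cast // -{1}(expn0 p) ltn_exp2l // prime_gt1. Qed.

Lemma Zp_natr_eq k a b :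
  (a%:R = b%:R :> 'Z_(p ^ k.+1)) <-> (a = b %[mod p ^ k.+1])%N.
Proof.
split=> [/(congr1 (@nat_of_ord _))|ab].
  by rewrite !Zp_nat /= Zp_cast_exp.
by apply: val_inj; rewrite !Zp_nat /= Zp_cast_exp.
Qed.

Lemma Zp_exp_eq0 k : (p%:R : 'Z_(p ^ k.+1)) ^+ k.+1 = 0.
Proof. by rewrite -natrX; apply/(Zp_natr_eq k _ 0); rewrite modnn mod0n. Qed.

Lemma res_addn k i x : (res (k + i) x : nat)%:R = res k x.
Proof.
elim: i => [|i IH]; first by rewrite addn0 natr_Zp.
rewrite -IH addnS -[res (k + i) x]reduce_res; apply/Zp_natr_eq.
rewrite /reduce Zp_nat /= (Zp_cast_exp (k + i)) modn_dvdm // dvdn_exp2l //.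
by rewrite ltnS leq_addr.
Qed.

(** The inverse is the geometric series in [x = - p r]: modulo p^(k+1) it stops after k+1 terms, so
    these partial sums form a coherent sequence. *)
Lemma jacobson_padic : in_jacobson (p%:R : padic_int p).
Proof.
move=> r; pose x := - (p%:R * r); pose S k := \sum_(i < k) x ^+ i.
have x0 k : res k x ^+ k.+1 = 0.
  by rewrite rmorphN rmorphM rmorph_nat -mulrN exprMn Zp_exp_eq0 mul0r.
have [k|s sE] := @res_lift (fun k => res k (S k.+1)).
  by rewrite reduce_res /S [in LHS]big_ord_recr rmorphD rmorphXn /= x0 addr0.
exists s; apply: res_inj => k.
have resM : {morph res k : a b / a * b} by exact: rmorphM.
rewrite resM sE -resM.
have -> : 1 + p%:R * r = - (x - 1) by rewrite opprB opprK.
by rewrite mulNr -subrX1 opprB rmorphB rmorphXn x0 subr0.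
Qed.

Lemma res_eq0P k z : res k z = 0 -> exists w, z = p%:R ^+ k.+1 * w.
Proof.
move=> z0.
have dvd_z j : (p ^ k.+1 %| (res (k.+1 + j) z : nat))%N.
  have := z0; rewrite -(res_addn k j.+1) addnS -addSn => /(Zp_natr_eq k _ 0).
  by rewrite mod0n => /eqP.
(* Dividing by p^(k+1) costs k+1 digits, so the quotient modulo p^(j+1) is read off the residue of
   [z] modulo p^(k+j+2). *)
pose f j : 'Z_(p ^ j.+1) := ((res (k.+1 + j) z : nat) %/ p ^ k.+1)%:R.
have [|w wE] := @res_lift f.
  move=> j; rewrite /f reduceE; apply/Zp_natr_eq.
  have := reduce_res (k.+1 + j) z; rewrite -[RHS]natr_Zp /reduce => /Zp_natr_eq.
  by rewrite !modn_divl -expnD [(j.+1 + _)%N]addnC addnS => ->.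
exists w; apply: res_inj => j.
have resM : {morph res j : a b / a * b} by exact: rmorphM.
rewrite resM wE -natrX (_ : res j (_ ^ _)%:R = (p ^ k.+1)%:R); last first.
  exact: (rmorph_nat (res j)).
by rewrite /f -natrM mulnC divnK // addnC res_addn.
Qed.
End Residue.

(** * Cokernels under unit factors and perturbations *)

Section CokTransport.
Local Open Scope quotient_scope.
Variables (R : comNzRingType) (n : nat) (Z Z' : 'M[R]_n).

Definition cok_map (u : cok Z) : cok Z' := \pi_(cok Z') (repr u).

Hypothesis image_sub : {subset mx_image Z <= mx_image Z'}.

Lemma cok_map_pi v : cok_map (\pi_(cok Z) v) = \pi_(cok Z') v.
Proof.
apply/eqP; rewrite /cok_map -Quotient.idealrBE; apply: image_sub.
by rewrite Quotient.idealrBE reprK.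
Qed.

Lemma cok_map_linear : linear cok_map.
Proof.
move=> a u v; rewrite -[u]reprK -[v]reprK.
rewrite -[a *: _]/(cok_scale a _) cok_scale_pi.
rewrite -(raddfD \pi_(Quotient.quot (mx_image Z))) !cok_map_pi.
rewrite -[RHS]/(cok_scale a _ + _) cok_scale_pi.
exact: (raddfD \pi_(Quotient.quot (mx_image Z'))).
Qed.
End CokTransport.

Lemma cok_mapK (R : comNzRingType) (n : nat) (Z Z' : 'M[R]_n) :
  {subset mx_image Z <= mx_image Z'} -> {subset mx_image Z' <= mx_image Z} ->
  cancel (@cok_map R n Z Z') (@cok_map R n Z' Z).
Proof.
by move=> ZZ' Z'Z u; rewrite -{1}[u]reprK !cok_map_pi // !reprK.
Qed.

Lemma cok_isomorphic_eq_image (R : comNzRingType) (n : nat) (Z Z' : 'M[R]_n)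
    (G : lmodType R) :
  mx_image Z =i mx_image Z' ->
  lmod_isomorphic (cok Z) G -> lmod_isomorphic (cok Z') G.
Proof.
move=> ZZ' [f bij_f].
have subZ : {subset mx_image Z <= mx_image Z'} by move=> v; rewrite ZZ'.
have subZ' : {subset mx_image Z' <= mx_image Z} by move=> v; rewrite ZZ'.
pose gM := GRing.isLinear.Build R (cok Z') (cok Z) _ _ (cok_map_linear subZ').
pose g : {linear cok Z' -> cok Z} := HB.pack (@cok_map R n Z' Z) gM.
exists (f \o g); apply: bij_comp => //.
by exists (@cok_map R n Z Z'); exact: cok_mapK.
Qed.

(** A right-invertible [U] is onto, so [Z *m U] and [Z] have the same image. *)
Lemma cok_isomorphic_mulmx (R : comNzRingType) (n : nat) (Z U V : 'M[R]_n)
    (G : lmodType R) :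
  U *m V = 1%:M ->
  lmod_isomorphic (cok (Z *m U)) G <-> lmod_isomorphic (cok Z) G.
Proof.
move=> UV.
have im : mx_image (Z *m U) =i mx_image Z.
  move=> v; apply/asboolP/asboolP => -[w ->].
    by exists (U *m w); rewrite mulmxA.
  by exists (V *m w); rewrite -mulmxA [U *m _]mulmxA UV mul1mx.
by split; apply: cok_isomorphic_eq_image => // v; rewrite im.
Qed.

(** The sum of all elements of [G] is unchanged when each is translated by [g]. *)
Lemma finLmod_mulrn_card (R : nzRingType) (G : finLmodType R) (g : G) :
  g *+ #|G| = 0.
Proof.
have /eqP : \sum_(x : G) x = \sum_(x : G) (x + g).
  exact: (reindex_inj (addIr g)).
by rewrite big_split /= -subr_eq0 opprD addNKr oppr_eq0 sumr_const => /eqP.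
Qed.

(** The order of [G] kills the cokernel, so each basis vector times [#|G|] lies in the image of [Z];
    chosen preimages are the columns of [V]. *)
Lemma cok_finite_scalar (R : comNzRingType) (n : nat) (Z : 'M[R]_n)
    (G : finLmodType R) :
  lmod_isomorphic (cok Z) G -> exists V, Z *m V = (#|G|%:R)%:M.
Proof.
case=> f bij_f.
have im j : exists w : 'cV_n, col j ((#|G|%:R)%:M) = Z *m w.
  suff /asboolP : col j (#|G|%:R)%:M \in mx_image Z by [].
  have -> : col j (#|G|%:R)%:M = col j 1%:M *+ #|G| :> 'cV[R]_n.
    by apply/colP => i; rewrite !(mxE, mulmxnE) -mulrnA mulnC mulrnA.
  rewrite -[X in X \in _]subr0.
  rewrite (Quotient.idealrBE (mx_image Z)); apply/eqP/(bij_inj bij_f).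
  rewrite (raddf0 \pi_(Quotient.quot (mx_image Z))%qT).
  rewrite (raddfMn \pi_(Quotient.quot (mx_image Z))%qT).
  rewrite (raddfMn f) (raddf0 f).
  exact: finLmod_mulrn_card.
have [w wE] := choice im.
exists (\matrix_(i, j) w j i 0); apply/matrixP => i j.
have /matrixP/(_ i 0) := wE j; rewrite !mxE => ->.
by apply: eq_bigr => k _; rewrite !mxE.
Qed.

Lemma cok_isomorphic_perturb (R : comNzRingType) (n : nat) (Z B : 'M[R]_n) (a : R)
    (G : finLmodType R) :
  in_jacobson a -> lmod_isomorphic (cok Z) G ->
  lmod_isomorphic (cok (Z + (#|G|%:R * a) *: B)) G.
Proof.
move=> jac_a ZG; have [V ZV] := cok_finite_scalar ZG.
have -> : Z + (#|G|%:R * a) *: B = Z *m (1%:M + a *: (V *m B)).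
  by rewrite mulmxDr mulmx1 -scalemxAr mulmxA ZV mul_scalar_mx scalerA mulrC.
have [W UW] := jacobson_mx (V *m B) jac_a.
exact/(cok_isomorphic_mulmx _ _ UW).
Qed.

(** * Haar mass of unions of residue classes *)

Section HaarMass.
Variables (p n : nat) (K : realType) (mu : probability (borel_padic_mx p n) K).
Variable k : nat.
Local Notation redmx := (map_mx (@res p k) : 'M[padic_int p]_n -> 'M['Z_(p ^ k.+1)]_n).

Definition residue_saturated (E : set 'M[padic_int p]_n) : Prop :=
  forall X X', redmx X = redmx X' -> E X -> E X'.

Lemma measurable_saturated E :
  residue_saturated E -> measurable (E : set (borel_padic_mx p n)).
Proof.
move=> satE; apply: sub_sigma_algebra.
(* The set is open: around each of its points it contains the whole class modulo p^(k+1), a product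
   of basic neighbourhoods of the entries. *)
rewrite openE => X EX; exists (fun i j => [set y | residue y k = residue (X i j) k]).
  by move=> i j; exists k.
move=> X' /= XX'; apply: satE EX; apply/matrixP => i j.
by rewrite !mxE; apply/esym/XX'.
Qed.

Hypothesis mu_haar : is_haar mu.

(** The class of [X] is the translate by [X] of the class of 0. *)
Lemma haar_residue_class X : mu (redmx @^-1` [set redmx X]) = mu (redmx @^-1` [set 0]).
Proof.
rewrite -[RHS](mu_haar X); last first.
  by apply: measurable_saturated => Y Y' /= ->.
congr (mu _); apply/seteqP; split => [Y /= YX|_ [Y /= Y0 <-]].
  exists (Y - X); last by rewrite addrC subrK.
  by rewrite /= raddfB /= YX subrr.
by rewrite /= raddfD /= Y0 addr0.
Qed.

Lemma haar_saturated E : residue_saturated E ->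
  mu E = (\sum_(s \in redmx @` E) mu (redmx @^-1` [set 0%R]))%E.
Proof.
move=> satE.
have {1}-> : E = \bigcup_(s in redmx @` E) (redmx @^-1` [set s]).
  apply/seteqP; split => [X EX|X [_ [X' EX' <-]] /= XX'].
    by exists (redmx X) => //; exists X.
  by apply: satE EX'.
rewrite measure_fin_bigcup.
- by apply: eq_fsbigr => _ /set_mem[X _ <-]; exact: haar_residue_class.
- exact: finite_finset.
- by move=> s s' _ _ [X [/= <- <-]].
- by move=> s _; apply: measurable_saturated => Y Y' /= ->.
Qed.

(** The mass of a saturated set only depends on how many classes it meets. The map [f] induced by
    [g] permutes the finite set of classes and carries those of [E1] onto those of [E2]. *)
Lemma haar_saturated_eq E1 E2 (g : 'M[padic_int p]_n -> 'M[padic_int p]_n)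
    (f : 'M['Z_(p ^ k.+1)]_n -> 'M['Z_(p ^ k.+1)]_n) :
  injective f -> (forall X, redmx (g X) = f (redmx X)) ->
  (forall X, E1 X <-> E2 (g X)) ->
  residue_saturated E1 -> residue_saturated E2 -> mu E1 = mu E2.
Proof.
move=> f_inj gf E12 sat1 sat2.
rewrite (haar_saturated sat1) (haar_saturated sat2).
apply: esym; apply: (reindex_fsbig f); split.
- move=> _ [X EX <-]; exists (g X); [exact/E12 | exact: gf].
- by move=> s s' _ _; exact: f_inj.
- move=> _ [X EX <-].
  have [h fK hK] := injF_bij f_inj.
  (* For surjectivity, lift the [f]-preimage of the class of [X] to a p-adic [X']: then [g X'] lies
     in the class of [X], hence in [E2], and [X'] in [E1]. *)
  have [X' X'E] : exists X', redmx X' = h (redmx X).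
    have [r rE] := choice (@res_surj p k).
    by exists (map_mx r (h (redmx X))); apply/matrixP => i j; rewrite !mxE rE.
  exists (h (redmx X)); last exact: hK.
  by exists X' => //; apply/E12; apply: sat2 EX; rewrite gf X'E hK.
Qed.
End HaarMass.

(** * The substitution psi *)

Section Twist.
Variables (R : comNzRingType) (n m : nat).
Implicit Types (a t : R) (X : 'M[R]_n) (Y : 'I_m -> 'M[R]_n).

(** This is psi with [a] in place of p, over an arbitrary commutative ring because it is needed over
    Z_p, over R and over Z/p^(k+1). *)
Definition twist a Y X := X - a *: \sum_(i < m) X ^+ i.+1 *m Y i.

(** The scalar t commutes with [X], so [X - t] divides X^(i+1) - t^(i+1) on the left with quotient
    [geo i]. *)
Lemma twist_factor a t Y X :
  exists W, twist a Y X - t%:M + \sum_(i < m) t ^+ i.+1 *: (a *: Y i) =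
            (X - t%:M) *m (1%:M + a *: W).
Proof.
pose geo i := \sum_(j < i.+1) X ^+ (i.+1.-1 - j) * (t%:M : 'M[R]_n) ^+ j.
have geoE i : (X - t%:M) *m geo i = X ^+ i.+1 - (t ^+ i.+1)%:M.
  by rewrite (rmorphXn (@scalar_mx R n)) -[LHS]subrXX_comm //; exact: comm_mx_scalar.
exists (- \sum_(i < m) geo i *m Y i).
rewrite mulmxDr mulmx1 /twist -scalemxAr mulmxN mulmx_sumr.
under [in RHS]eq_bigr do rewrite mulmxA geoE mulmxBl mul_scalar_mx.
rewrite sumrB opprB scalerBr [a *: _ - _]addrC addrA [X - t%:M - _]addrAC.
congr (_ + _); rewrite scaler_sumr.
by apply: eq_bigr => i _; rewrite !scalerA mulrC.
Qed.

Lemma exprmx_sub_dvd c X X' B i : X - X' = c *: B ->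
  exists C, X ^+ i - X' ^+ i = c *: C.
Proof.
move=> XX'; elim: i => [|i [C CE]]; first by exists 0; rewrite subrr scaler0.
(* [X] and [X'] need not commute, hence the telescoping X^(i+1) - X'^(i+1) = X (X^i - X'^i) + (X -
   X') X'^i. *)
exists (X *m C + B *m X' ^+ i).
rewrite scalerDr scalemxAr [c *: (B *m _)]scalemxAl -XX' -CE mulmxBl mulmxBr addrA subrK.
by rewrite !exprS.
Qed.

Lemma twist_inj a Y k : a ^+ k = 0 -> injective (twist a Y).
Proof.
move=> ak0 X X' tXX'.
have XX' : X - X' = a *: \sum_(i < m) (X ^+ i.+1 - X' ^+ i.+1) *m Y i.
  under eq_bigr do rewrite mulmxBl.
  move/eqP: tXX'; rewrite sumrB scalerBr /twist subr_eq => /eqP {1}->.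
  by rewrite addrC -!addrA addKr addrC.
(* If a^j divides X - X', it divides every difference of powers, and the extra factor [a] in [XX']
   raises the exponent to j+1; nilpotency of [a] ends the ascent. *)
suff H j : exists B, X - X' = a ^+ j *: B.
  by have [B] := H k; rewrite ak0 scale0r => /eqP; rewrite subr_eq0 => /eqP.
elim: j => [|j [B BE]]; first by exists (X - X'); rewrite scale1r.
have /choice[C CE] i : exists C, X ^+ i - X' ^+ i = a ^+ j *: C.
  exact: exprmx_sub_dvd BE.
exists (\sum_(i < m) C i.+1 *m Y i).
rewrite XX' exprS -scalerA; congr (_ *: _).
by rewrite scaler_sumr; apply: eq_bigr => i _; rewrite CE scalemxAl.
Qed.
End Twist.

Lemma map_twist (R S : comNzRingType) (f : {rmorphism R -> S}) (n m : nat)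
    (a : R) (Y : 'I_m -> 'M[R]_n) (X : 'M[R]_n) :
  map_mx f (twist a Y X) = twist (f a) (fun i => map_mx f (Y i)) (map_mx f X).
Proof.
rewrite /twist map_mxB map_mxZ raddf_sum; congr (_ - _ *: _).
by apply: eq_bigr => i _; rewrite /= map_mxM rmorphXn.
Qed.

(** * Saturation of the events and their matching under psi *)

Lemma padic_pfactor (p m : nat) : prime p -> (0 < m)%N ->
  exists c : padic_int p, p%:R ^+ (logn p m).+1 = m%:R * p%:R * c.
Proof.
move=> p_pr m_gt0; have [u pu {2}->] := pfactor_coprime p_pr m_gt0.
have u_gt0 : (0 < u)%N.
  by case: u pu => //; rewrite /coprime gcdn0 => /eqP p1; rewrite p1 in p_pr.
(* Here m = u p^v with u prime to p. Bezout gives b u = 1 + p c, a unit of Z_p with inverse [s], so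
   b s inverts u. *)
have [b c ubc _] := egcdnP p u_gt0.
rewrite gcdnC (eqP pu) in ubc.
have [s sE] := jacobson_padic p_pr c%:R.
exists (b%:R * s).
have bu : b%:R * u%:R = 1 + p%:R * c%:R :> padic_int p.
  by rewrite -!natrM ubc addn1 mulrSr addrC mulnC.
rewrite -bu in sE; rewrite natrM natrX exprS -[LHS]mul1r -[X in X * _ = _]sE.
ring.
Qed.

Section CokSaturated.
Variables (p n : nat) (P : {poly padic_int p}) (G : finLmodType {poly %/ P}).
Hypothesis p_prime : prime p.

(** Level [logn p #|G|] means congruence modulo p^(v+1), where v is the valuation of [#|G|]. Such a
    difference is a multiple of [#|G| p]: the factor [#|G|] is absorbed by the cokernel, the spare p
    lies in the Jacobson radical. *)
Lemma saturated_cok (C : 'M[{poly %/ P}]_n) :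
  residue_saturated (logn p #|G|)
    [set X | lmod_isomorphic (cok (map_mx (qpolyC P) X + C)) G].
Proof.
move=> X X' XX' /= XG.
have G_gt0 : (0 < #|G|)%N by apply/card_gt0P; exists 0.
have [c cE] := padic_pfactor p_prime G_gt0.
have dvd i j : exists w, X' i j = X i j + p%:R ^+ (logn p #|G|).+1 * w.
  have [|w wE] := @res_eq0P _ p_prime (logn p #|G|) (X' i j - X i j).
    by move/matrixP/(_ i j): XX'; rewrite !mxE rmorphB /= => ->; rewrite subrr.
  by exists w; rewrite -wE addrC subrK.
have [B BE] : exists B, X' = X + (#|G|%:R * p%:R) *: B.
  have /choice[w wE] ij := dvd ij.1 ij.2.
  exists (\matrix_(i, j) (c * w (i, j))); apply/matrixP => i j.
  by rewrite !mxE (wE (i, j)) cE !mulrA.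
have -> : map_mx (qpolyC P) X' + C =
    map_mx (qpolyC P) X + C + (#|G|%:R * qpolyC P p%:R) *: map_mx (qpolyC P) B.
  by rewrite BE map_mxD map_mxZ rmorphM rmorph_nat addrAC.
apply: cok_isomorphic_perturb XG.
exact/jacobson_qpoly/jacobson_padic.
Qed.
End CokSaturated.

Lemma saturated_residue_class (p n k : nat) (A : 'M['F_p]_n) :
  residue_saturated k (residue_class A).
Proof.
move=> X X' XX' <-; apply/matrixP => i j; rewrite !mxE /padic_mod_p.
suff -> : residue (X' i j) 0%N = residue (X i j) 0%N by [].
apply: (padic_residue_le (leq0n k)).
by move/matrixP/(_ i j): XX'; rewrite !mxE /res => ->.
Qed.

Lemma residue_class_twist (p n m : nat) (A : 'M['F_p]_n)
    (Y : 'I_m -> 'M[padic_int p]_n) (X : 'M[padic_int p]_n) :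
  prime p -> residue_class A X <-> residue_class A (twist p%:R Y X).
Proof.
move=> p_prime.
(* At level 0 the ring is Z/p, where p = 0 and the twist is the identity. *)
have red0 : map_mx (@res p 0) (twist p%:R Y X) = map_mx (@res p 0) X.
  rewrite map_twist rmorph_nat -[p%:R]expr1 Zp_exp_eq0 // /twist.
  by rewrite scale0r subr0.
by split; exact: (@saturated_residue_class p n 0).
Qed.

Lemma lmod_isomorphic_cok_twist (p n m : nat) (P : {poly padic_int p})
    (G : lmodType {poly %/ P}) (Y : 'I_m -> 'M[padic_int p]_n)
    (X : 'M[padic_int p]_n) :
  prime p ->
  lmod_isomorphic (cok (map_mx (qpolyC P) X - ('qX)%:M)) G <->
  lmod_isomorphic
    (cok (map_mx (qpolyC P) (twist p%:R Y X) - ('qX)%:M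
          + \sum_(i < m) 'qX ^+ i.+1 *: map_mx (qpolyC P) (p%:R *: Y i))) G.
Proof.
move=> p_prime.
have -> : \sum_(i < m) 'qX ^+ i.+1 *: map_mx (qpolyC P) (p%:R *: Y i) =
    \sum_(i < m) 'qX ^+ i.+1 *: (p%:R *: map_mx (qpolyC P) (Y i)).
  by apply: eq_bigr => i _; rewrite map_mxZ rmorph_nat.
rewrite map_twist rmorph_nat.
have [W ->] := twist_factor p%:R ('qX : {poly %/ P})
  (fun i => map_mx (qpolyC P) (Y i)) (map_mx (qpolyC P) X).
have [V WV] : exists V, (1%:M + p%:R *: W) *m V = 1%:M.
  apply: jacobson_mx; rewrite -(rmorph_nat (qpolyC P)).
  exact/jacobson_qpoly/jacobson_padic.
by apply: iff_sym; exact: cok_isomorphic_mulmx WV.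
Qed.

Lemma eq_class_prob (p n : nat) (K : realType)
    (mu : probability (borel_padic_mx p n) K) (A : 'M['F_p]_n)
    (E1 E2 : set 'M[padic_int p]_n) :
  mu (residue_class A `&` E1) = mu (residue_class A `&` E2) ->
  class_prob mu A E1 = class_prob mu A E2.
Proof. by rewrite /class_prob => ->. Qed.

Theorem theorem2p4 (K : realType) (p : nat) (P : {poly padic_int p})
    (d n : nat) (A : 'M['F_p]_n) (G : finLmodType {poly %/ P})
    (mu : probability (borel_padic_mx p n) K)
    (Y : 'I_d.-1 -> 'M[padic_int p]_n) :
  prime p -> (0 < d)%N -> P \is monic -> size P = d.+1 -> (0 < n)%N ->
  is_haar mu ->
  class_prob mu A
    [set X | lmod_isomorphic (cok (map_mx (qpolyC P) X - ('qX)%:M)) G] =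
  class_prob mu A
    [set X | lmod_isomorphic
       (cok (map_mx (qpolyC P) X - ('qX)%:M
             + \sum_(i < d.-1)
                 'qX ^+ i.+1 *: map_mx (qpolyC P) (p%:R *: Y i))) G].
Proof.
move=> p_prime _ _ _ _ mu_haar; apply: eq_class_prob.
pose k := logn p #|G|.
apply: (@haar_saturated_eq p n K mu k mu_haar _ _ (twist p%:R Y)
  (twist p%:R (fun i => map_mx (@res p k) (Y i)))).
(* In Z/p^(k+1) the element p is nilpotent of exponent k+1. *)
- by apply: (@twist_inj _ _ _ _ _ k.+1); exact: Zp_exp_eq0.
- by move=> X; rewrite map_twist rmorph_nat.
- move=> X; split=> -[XA XG]; split.
  + exact: (iffLR (residue_class_twist _ _ _ p_prime) XA).
  + exact: (iffLR (@lmod_isomorphic_cok_twist p n d.-1 P G Y X p_prime) XG).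
  + exact: (iffRL (residue_class_twist _ _ _ p_prime) XA).
  + exact: (iffRL (@lmod_isomorphic_cok_twist p n d.-1 P G Y X p_prime) XG).
- move=> X X' XX' [XA XG].
  split; first exact: (saturated_residue_class XX' XA).
  exact: (saturated_cok p_prime XX' XG).
(* Reassociating makes -t plus the sum the constant matrix [C] of [saturated_cok]. *)
- move=> X X' XX' [XA]; rewrite /= -addrA => XG.
  split; first exact: (saturated_residue_class XX' XA).
  by rewrite /= -addrA; exact: (saturated_cok p_prime XX' XG).
Qed.
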